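(* Let $\omega(x,y,z) = [x,y]z$ (anti-Jordan family, $q=2$) and $\omega'(x,y,z) = x[y,z]$ (anti-Jordan family, $q=-1$), where $[u,v]=uv-vu$. Then $U(A^{\omega})\cong U(A^{\omega'})$ as unital associative algebras.
   Context: $\mathbb{F}$ is a field of characteristic $0$. $A$ is the 2-dimensional space of $2\times 2$ matrices over $\mathbb{F}$ with zero diagonal, with basis $e_1 = \begin{bmatrix} 0&1\\0&0\end{bmatrix}$, $e_2 = \begin{bmatrix} 0&0\\1&0\end{bmatrix}$; it is closed under triple products $xyz$ of matrices. For a trilinear operation $\omega(x,y,z)$ (a fixed rational linear combination of the six products of $x,y,z$ in all orders), $A^\omega$ denotes the space $A$ with the trilinear operation $\omega$ computed using matrix multiplication. Let $\mathbb{F}\langle a,b\rangle$ be the free unital associative algebra and $\phi\colon A \to \mathbb{F}\langle a,b\rangle$ the linear map with $\phi(e_1)=a$, $\phi(e_2)=b$. The universal associative envelope is $U(A^\omega) = \mathbb{F}\langle a,b\rangle / I$, where $I$ is the two-sided ideal generated by the elements $\omega(\phi(x),\phi(y),\phi(z)) - \phi(\omega(x,y,z))$ for $x,y,z\in\{e_1,e_2\}$. *)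

(* Defs.v *)
From HB Require Import structures.
From mathcomp Require Import all_boot all_algebra.
From mathcomp Require Import monalg.
From mathcomp.classical Require Import boolp.

Set Implicit Arguments.
Unset Strict Implicit.
Unset Printing Implicit Defensive.

Import GRing.Theory.
Local Open Scope ring_scope.
Local Open Scope quotient_scope.

Section MalgAlgebra.
Context (R : comNzRingType) (K : monomType).

Lemma malg_scalerAr (k : R) (x y : {malg R[K]}) : k *: (x * y) = x * (k *: y).
Proof.
have malgCc c (g : {malg R[K]}) : g * malgC c = malgC c * g.
  rewrite mul_malgC malgM_def malgZ_def fgmulgU.
  by apply: eq_bigr => m _; rewrite mulm1 mulrC.
by rewrite -!mul_malgC !mulrA malgCc.
Qed.

End MalgAlgebra.

(* A trilinear operation: its coefficients on the six products of x, y, z. *)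
Record triop := Triop {
  c_xyz : rat; c_xzy : rat; c_yxz : rat; c_yzx : rat; c_zxy : rat; c_zyx : rat
}.

Definition triop_eval (w : triop) (F : fieldType) (B : algType F) (x y z : B) : B :=
  ratr (c_xyz w) *: (x * y * z) + ratr (c_xzy w) *: (x * z * y) +
  ratr (c_yxz w) *: (y * x * z) + ratr (c_yzx w) *: (y * z * x) +
  ratr (c_zxy w) *: (z * x * y) + ratr (c_zyx w) *: (z * y * x).

(* [x,y]z = xyz - yxz *)
Definition omega_comm_l : triop :=
  {| c_xyz := 1; c_xzy := 0; c_yxz := -1; c_yzx := 0; c_zxy := 0; c_zyx := 0 |}.

(* x[y,z] = xyz - xzy *)
Definition omega_comm_r : triop :=
  {| c_xyz := 1; c_xzy := -1; c_yxz := 0; c_yzx := 0; c_zxy := 0; c_zyx := 0 |}.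

Section TriopEval.
Context (F : fieldType) (B : algType F).
Implicit Types x y z : B.

Let ratr0 : ratr 0 = 0 :> F. Proof. exact: (ratr_int F 0). Qed.
Let ratr1 : ratr 1 = 1 :> F. Proof. exact: (ratr_int F 1). Qed.
Let ratrN1 : ratr (-1) = -1 :> F. Proof. exact: (ratr_int F (-1)). Qed.

Lemma omega_comm_lE x y z :
  triop_eval omega_comm_l x y z = (x * y - y * x) * z.
Proof.
by rewrite /triop_eval /= ratr0 ratr1 ratrN1 !scale0r scale1r scaleN1r !addr0
  mulrBl.
Qed.

Lemma omega_comm_rE x y z :
  triop_eval omega_comm_r x y z = x * (y * z - z * y).
Proof.
by rewrite /triop_eval /= ratr0 ratr1 ratrN1 !scale0r scale1r scaleN1r !addr0
  mulrBr !mulrA.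
Qed.

Lemma triop_eval_ker (w : triop) (f : {rmorphism B -> F}) x y z :
    (forall k p, f (k *: p) = k * f p) ->
  f x = 0 -> f y = 0 -> f z = 0 -> f (triop_eval w x y z) = 0.
Proof.
move=> fZ x0 y0 z0.
by rewrite /triop_eval !rmorphD !fZ !rmorphM x0 y0 z0 !mulr0 !addr0.
Qed.

End TriopEval.

Section ZeroDiagonal.
Context (F : fieldType).

Definition zero_diag : {pred 'M[F]_2} :=
  fun M => [forall i, M i i == 0].

Lemma zero_diag_submod : submod_closed zero_diag.
Proof.
split=> [|k u v /forallP u0 /forallP v0]; apply/forallP => i; rewrite !mxE //.
by rewrite (eqP (u0 i)) (eqP (v0 i)) mulr0 addr0.
Qed.

HB.instance Definition _ :=
  GRing.isSubmodClosed.Build F 'M[F]_2 zero_diag zero_diag_submod.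

Record zdmx := ZDMx { zdmx_val :> 'M[F]_2; _ : zdmx_val \in zero_diag }.

HB.instance Definition _ := [isSub for zdmx_val].
HB.instance Definition _ := [Choice of zdmx by <:].
HB.instance Definition _ := [SubChoice_isSubLmodule of zdmx by <:].

Lemma zero_diag_mul3 (x y z : 'M[F]_2) :
  x \in zero_diag -> y \in zero_diag -> z \in zero_diag -> x * y * z \in zero_diag.
Proof.
move=> /forallP x0 /forallP y0 /forallP z0; apply/forallP => i.
rewrite mxE; apply/eqP/big1 => j _; rewrite mxE.
have [->|ji] := eqVneq j i; first by rewrite (eqP (z0 i)) mulr0.
rewrite big1 ?mul0r // => k _.
have [->|ki] := eqVneq k i; first by rewrite (eqP (x0 i)) mul0r.
suff -> : k = j by rewrite (eqP (y0 j)) mulr0.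
by case: i j k ji ki {x0 y0 z0} => [[|[|?]] ?] [[|[|?]] ?] [[|[|?]] ?] //= _ _;
  apply: val_inj.
Qed.

Lemma zero_diag_triop (w : triop) (x y z : zdmx) :
  triop_eval w (x : 'M[F]_2) (y : 'M[F]_2) (z : 'M[F]_2) \in zero_diag.
Proof. by rewrite !rpredD // rpredZ // zero_diag_mul3 // (valP x, valP y, valP z). Qed.

(* The operation of A^omega. *)
Definition zdmx_op (w : triop) (x y z : zdmx) : zdmx := ZDMx (zero_diag_triop w x y z).

Lemma zero_diag_delta (i j : 'I_2) : i != j -> delta_mx i j \in zero_diag.
Proof.
move=> ij; apply/forallP => k; rewrite mxE.
by case: (eqVneq k i) => [->|_] /=; rewrite ?(negPf ij) eqxx.
Qed.

Definition e1 : zdmx := ZDMx (zero_diag_delta (isT : 0 != 1 :> 'I_2)).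
Definition e2 : zdmx := ZDMx (zero_diag_delta (isT : 1 != 0 :> 'I_2)).

Lemma zdmx_linE (k : F) (x y : zdmx) (i j : 'I_2) :
  (k *: x + y) i j = k * x i j + y i j.
Proof. by rewrite !mxE. Qed.

Lemma zdmxE (x : zdmx) : x = x 0 1 *: e1 + x 1 0 *: e2.
Proof.
have /forallP x0 := valP x; apply/val_inj/matrixP => i j; rewrite !mxE.
have ord2 (k : 'I_2) : k = 0 \/ k = 1.
  by case: k => [[|[|?]] ?] //; [left|right]; apply: val_inj.
case: (ord2 i) => ->; case: (ord2 j) => -> /=;
  by rewrite ?(mulr1, mulr0, addr0, add0r) // (eqP (x0 _)).
Qed.

Section LinearExtension.
Context (B : algType F) (a b : B).

Definition lin_ext (x : zdmx) : B := x 0 1 *: a + x 1 0 *: b.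

Lemma lin_ext_linear : linear lin_ext.
Proof.
move=> k x y; rewrite /lin_ext !zdmx_linE !scalerDl scalerDr -!scalerA.
exact: addrACA.
Qed.

HB.instance Definition _ := GRing.isLinear.Build F zdmx B _ lin_ext lin_ext_linear.

Lemma lin_ext_e1 : lin_ext e1 = a.
Proof.
have [h1 h2] : e1 0 1 = 1 /\ e1 1 0 = 0 by rewrite !mxE.
by rewrite /lin_ext h1 h2 scale1r scale0r addr0.
Qed.

Lemma lin_ext_e2 : lin_ext e2 = b.
Proof.
have [h1 h2] : e2 0 1 = 0 /\ e2 1 0 = 1 by rewrite !mxE.
by rewrite /lin_ext h1 h2 scale1r scale0r add0r.
Qed.

Lemma lin_ext_ker (f : {rmorphism B -> F}) x :
  (forall k p, f (k *: p) = k * f p) -> f a = 0 -> f b = 0 -> f (lin_ext x) = 0.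
Proof. by move=> fZ a0 b0; rewrite rmorphD !fZ a0 b0 !mulr0 addr0. Qed.

End LinearExtension.

(* F<a,b> as the monoid algebra of the free monoid on two letters. *)
Definition freealg2 := {malg F[{fmonom 'I_2}]}.
HB.instance Definition _ := GRing.Lalgebra.on freealg2.
HB.instance Definition _ :=
  GRing.LSemiAlgebra_isSemiAlgebra.Build F freealg2 (@malg_scalerAr F _).

Definition gen_a : freealg2 := << fmu (0 : 'I_2) >>.
Definition gen_b : freealg2 := << fmu (1 : 'I_2) >>.

Definition phi : zdmx -> freealg2 := lin_ext gen_a gen_b.
HB.instance Definition _ := GRing.Linear.on phi.

End ZeroDiagonal.

Section GeneratedIdeal.
Context (B : nzRingType) (G : B -> Prop).

(* Two-sided ideal generated by G: finite sums of elements u g v, g in G. *)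
Definition in_ideal_gen (p : B) : Prop :=
  exists2 s : seq (B * B * B),
    (forall t, t \in s -> G t.1.2) & p = \sum_(t <- s) t.1.1 * t.1.2 * t.2.

Definition ideal_gen : {pred B} := fun p => `[< in_ideal_gen p >].

Lemma ideal_genP p : reflect (in_ideal_gen p) (p \in ideal_gen).
Proof. exact: asboolP. Qed.

Lemma mem_ideal_gen p : G p -> p \in ideal_gen.
Proof.
move=> Gp; apply/ideal_genP; exists [:: (1, p, 1)].
  by move=> t; rewrite inE => /eqP ->.
by rewrite big_seq1 /= mul1r mulr1.
Qed.

Lemma ideal_genM u v p : p \in ideal_gen -> u * p * v \in ideal_gen.
Proof.
move=> /ideal_genP[s sG ->].
apply/ideal_genP; exists [seq (u * t.1.1, t.1.2, t.2 * v) | t <- s].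
  by move=> t /mapP[t' /sG ? ->].
rewrite big_map mulr_sumr mulr_suml.
by apply: eq_bigr => t _; rewrite !mulrA.
Qed.

Lemma ideal_gen_zmod : zmod_closed ideal_gen.
Proof.
split=> [|p q pI qI].
  by apply/ideal_genP; exists [::]; rewrite ?big_nil.
have /ideal_genP[s sG ->] := pI.
have /ideal_genP[t tG] := ideal_genM (-1) 1 qI; rewrite mulN1r mulr1 => ->.
apply/ideal_genP; exists (s ++ t); last by rewrite big_cat.
by move=> u; rewrite mem_cat => /orP[/sG|/tG].
Qed.

Lemma ideal_gen_ker (S : nzRingType) (f : {rmorphism B -> S}) p :
  (forall g, G g -> f g = 0) -> p \in ideal_gen -> f p = 0.
Proof.
move=> fG /ideal_genP[s sG ->]; rewrite rmorph_sum big_seq big1 // => t /sG /fG tG.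
by rewrite !rmorphM tG mulr0 mul0r.
Qed.

End GeneratedIdeal.

(* The quotient of an algebra by a proper two-sided ideal; ring_quotient only
   provides the ring structure of the quotient in the commutative case. *)
HB.mixin Record isProperIdeal2 (B : nzRingType) (S : B -> bool) := {
  ideal2_mul_subproof : forall u v p : B, p \in S -> u * p * v \in S;
  ideal2_1_subproof : 1 \notin S
}.

#[short(type="ideal2")]
HB.structure Definition Ideal2 (B : nzRingType) :=
  {S of GRing.ZmodClosed B S & isProperIdeal2 B S}.

Section QuotientAlgebra.
Context (F : fieldType) (B : algType F) (I : ideal2 B).

Lemma ideal2M (u v p : B) : p \in (I : {pred B}) -> u * p * v \in (I : {pred B}).
Proof. exact: ideal2_mul_subproof. Qed.

Definition quotalg : Type := {ideal_quot I}.
HB.instance Definition _ := GRing.Zmodule.on quotalg.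

Definition quotalg_pi (x : B) : quotalg := \pi_({ideal_quot I}) x.

Lemma quotalg_piP x y : quotalg_pi x = quotalg_pi y <-> x - y \in (I : {pred B}).
Proof. by rewrite Quotient.idealrBE; split=> [/eqP|/eqP]. Qed.

Definition quotalg_repr (x : quotalg) : B := repr (x : {ideal_quot I}).

Lemma quotalg_reprK : cancel quotalg_repr quotalg_pi.
Proof. exact: reprK. Qed.

Lemma quotalg_piK x : quotalg_repr (quotalg_pi x) - x \in (I : {pred B}).
Proof. exact/quotalg_piP/quotalg_reprK. Qed.

Lemma quotalg_pi_zmod : zmod_morphism quotalg_pi.
Proof. exact: (raddfB \pi_({ideal_quot I})). Qed.

HB.instance Definition _ :=
  GRing.isZmodMorphism.Build B quotalg quotalg_pi quotalg_pi_zmod.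

Definition quotalg_mul (x y : quotalg) : quotalg :=
  quotalg_pi (quotalg_repr x * quotalg_repr y).

Definition quotalg_scale (k : F) (x : quotalg) : quotalg :=
  quotalg_pi (k *: quotalg_repr x).

Let piM x y : quotalg_mul (quotalg_pi x) (quotalg_pi y) = quotalg_pi (x * y).
Proof.
apply/quotalg_piP; set x' := quotalg_repr _; set y' := quotalg_repr _.
have -> : x' * y' - x * y = 1 * (x' - x) * y' + x * (y' - y) * 1.
  by rewrite mul1r mulr1 mulrBl mulrBr addrA subrK.
by rewrite rpredD // ideal2M // quotalg_piK.
Qed.

Let piZ k x : quotalg_scale k (quotalg_pi x) = quotalg_pi (k *: x).
Proof.
apply/quotalg_piP; rewrite -scalerBr.
have -> : k *: (quotalg_repr (quotalg_pi x) - x) =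
    k%:A * (quotalg_repr (quotalg_pi x) - x) * 1.
  by rewrite mulr1 mulr_algl.
by rewrite ideal2M // quotalg_piK.
Qed.

Let piW (P : quotalg -> Prop) : (forall x, P (quotalg_pi x)) -> forall x, P x.
Proof. by move=> H x; rewrite -[x]quotalg_reprK. Qed.

Let mulA : associative quotalg_mul.
Proof. by elim/piW=> x; elim/piW=> y; elim/piW=> z; rewrite !piM mulrA. Qed.

Let mul1 : left_id (quotalg_pi 1) quotalg_mul.
Proof. by elim/piW=> x; rewrite piM mul1r. Qed.

Let mulr1' : right_id (quotalg_pi 1) quotalg_mul.
Proof. by elim/piW=> x; rewrite piM mulr1. Qed.

Let mulDl : left_distributive quotalg_mul +%R.
Proof.
by elim/piW=> x; elim/piW=> y; elim/piW=> z; rewrite -raddfD !piM -raddfD mulrDl.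
Qed.

Let mulDr : right_distributive quotalg_mul +%R.
Proof.
by elim/piW=> x; elim/piW=> y; elim/piW=> z; rewrite -raddfD !piM -raddfD mulrDr.
Qed.

Let one_neq0 : quotalg_pi 1 != 0.
Proof.
rewrite -(raddf0 quotalg_pi); apply/eqP => /quotalg_piP; rewrite subr0.
exact/negP/ideal2_1_subproof.
Qed.

HB.instance Definition _ :=
  GRing.Zmodule_isNzRing.Build quotalg mulA mul1 mulr1' mulDl mulDr one_neq0.

Let scaleA (a b : F) x : quotalg_scale a (quotalg_scale b x) = quotalg_scale (a * b) x.
Proof. by elim/piW: x => x; rewrite !piZ scalerA. Qed.

Let scale1 : left_id 1 quotalg_scale.
Proof. by elim/piW=> x; rewrite piZ scale1r. Qed.

Let scaleDr : right_distributive quotalg_scale +%R.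
Proof.
by move=> k; elim/piW=> x; elim/piW=> y; rewrite -raddfD !piZ -raddfD scalerDr.
Qed.

Let scaleDl x : {morph quotalg_scale^~ x : a b / a + b}.
Proof. by elim/piW: x => x a b /=; rewrite !piZ -raddfD scalerDl. Qed.

HB.instance Definition _ :=
  GRing.Zmodule_isLmodule.Build F quotalg scaleA scale1 scaleDr scaleDl.

Let mulE x y : quotalg_pi x * quotalg_pi y = quotalg_pi (x * y).
Proof. exact: piM. Qed.

Let scaleE (k : F) x : k *: quotalg_pi x = quotalg_pi (k *: x).
Proof. exact: piZ. Qed.

Let scaleAl (k : F) (x y : quotalg) : k *: (x * y) = k *: x * y.
Proof.
move: x y; elim/piW=> x; elim/piW=> y.
by rewrite mulE !scaleE mulE scalerAl.
Qed.

HB.instance Definition _ :=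
  GRing.LSemiModule_isLSemiAlgebra.Build F quotalg scaleAl.

Let scaleAr (k : F) (x y : quotalg) : k *: (x * y) = x * (k *: y).
Proof.
move: x y; elim/piW=> x; elim/piW=> y.
by rewrite mulE !scaleE mulE scalerAr.
Qed.

HB.instance Definition _ :=
  GRing.LSemiAlgebra_isSemiAlgebra.Build F quotalg scaleAr.

Lemma quotalg_pi_monoid : monoid_morphism quotalg_pi.
Proof. by split=> // x y; rewrite -piM. Qed.

HB.instance Definition _ :=
  GRing.isMonoidMorphism.Build B quotalg quotalg_pi quotalg_pi_monoid.

Lemma quotalg_pi_scalable : scalable quotalg_pi.
Proof. by move=> k x; rewrite -piZ. Qed.

HB.instance Definition _ :=
  GRing.isScalable.Build F B quotalg *:%R quotalg_pi quotalg_pi_scalable.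

End QuotientAlgebra.

Section EnvelopeRelations.
Context (F : fieldType) (w : triop) (B : algType F) (psi : zdmx F -> B).

Definition envelope_rel (g : B) : Prop :=
  exists x y z : zdmx F,
    [/\ x \in [:: e1 F; e2 F], y \in [:: e1 F; e2 F], z \in [:: e1 F; e2 F]
      & g = triop_eval w (psi x) (psi y) (psi z) - psi (zdmx_op w x y z)].

Lemma envelope_rel_ker (f : {rmorphism B -> F}) g :
  (forall k p, f (k *: p) = k * f p) -> (forall x, f (psi x) = 0) ->
  envelope_rel g -> f g = 0.
Proof.
move=> fZ f_psi [x [y [z [_ _ _ ->]]]].
by rewrite rmorphB f_psi subr0 (triop_eval_ker _ fZ).
Qed.

End EnvelopeRelations.

Section Envelope.
Context (F : fieldType) (w : triop).

Definition envelope_ideal : {pred freealg2 F} := ideal_gen (envelope_rel w (@phi F)).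

HB.instance Definition _ :=
  GRing.isZmodClosed.Build (freealg2 F) envelope_ideal
    (ideal_gen_zmod (envelope_rel w (@phi F))).

(* The ideal is proper since its generators have no constant term. *)
Lemma envelope_ideal1 : 1 \notin envelope_ideal.
Proof.
pose f : {rmorphism freealg2 F -> F} := @mcoeff {fmonom 'I_2} F mone.
have fZ k p : f (k *: p) = k * f p := @mcoeffZ _ F k p mone.
have f_letter i : f << fmu i >> = 0 :> F by rewrite /f /= mcoeffU1 fm1_eq1.
have f_phi x : f (phi x) = 0 := lin_ext_ker x fZ (f_letter 0) (f_letter 1).
have f_rel g : envelope_rel w (@phi F) g -> f g = 0 by apply: envelope_rel_ker.
by apply/negP => /(ideal_gen_ker f_rel)/eqP; rewrite rmorph1 oner_eq0.
Qed.

HB.instance Definition _ :=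
  isProperIdeal2.Build (freealg2 F) envelope_ideal
    (@ideal_genM _ (envelope_rel w (@phi F))) envelope_ideal1.

Definition envelope : algType F := quotalg envelope_ideal.

End Envelope.

(* Main.v *)
(* Put h = [a,b]. The relations of U(A^omega) are h a = a and h b = -b; those
   of U(A^omega') are a h = -a and b h = b. The first pair gives h^2 = ab + ba,
   hence 2 b a a = (h^2 - h) a = 0 and 2 a b b = (h^2 + h) b = 0. As 2 is
   invertible, b a a = a b b = 0, then a b a = a and b a b = b, and so
   a a = a b a a = 0 and b b = b a b b = 0: the second pair follows. Passing to
   opposite algebras exchanges the two pairs, so the two ideals of F<a,b>
   coincide. *)
Require Import Defs.
From HB Require Import structures.
From mathcomp Require Import all_boot all_algebra.
From mathcomp Require Import ring.
Import GRing.Theory.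
Local Open Scope ring_scope.

Set Implicit Arguments.
Unset Strict Implicit.
Unset Printing Implicit Defensive.

(** * Equivalence of the two pairs of relations in a ring without 2-torsion *)

Section CommutatorRelations.

(** Stated for any ring, hence also available in the opposite ring [B^c]. *)
Definition left_rels (B : pzRingType) (a b : B) :=
  (a * b - b * a) * a = a /\ (a * b - b * a) * b = - b.

Definition right_rels (B : pzRingType) (a b : B) :=
  a * (a * b - b * a) = - a /\ b * (a * b - b * a) = b.

(** Halving serves only to get b a a = 0 and a b b = 0 from their doubles, so absence of 2-torsion
    suffices. *)
Lemma left_rels_right (B : pzRingType) (a b : B) :
  (forall x : B, x *+ 2 = 0 -> x = 0) -> left_rels a b -> right_rels a b.
Proof.
move=> two_inj []; set h := a * b - b * a => ha hb.
have hh : h * h = a * b + b * a.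
  by rewrite {2}/h mulrBr !mulrA ha hb mulNr opprK.
have ba2 : b * a *+ 2 = h * h - h.
  by rewrite hh /h opprB addrC addrA subrK mulr2n.
have ab2 : a * b *+ 2 = h * h + h.
  by rewrite hh /h addrACA subrr addr0 mulr2n.
have baa : b * a * a = 0.
  by apply: two_inj; rewrite -mulrnAl ba2 mulrBl -mulrA !ha subrr.
have abb : a * b * b = 0.
  by apply: two_inj; rewrite -mulrnAl ab2 mulrDl -mulrA !hb mulrN hb opprK subrr.
have aba : a * b * a = a by rewrite -[RHS]ha mulrBl baa subr0.
have bab : b * a * b = b.
  by apply: oppr_inj; rewrite -[RHS]hb mulrBl abb sub0r.
have aa : a * a = 0 by rewrite -{1}aba -!mulrA [b * _]mulrA baa mulr0.
have bb : b * b = 0 by rewrite -{1}bab -!mulrA [a * _]mulrA abb mulr0.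
by split; rewrite mulrBr !mulrA ?aa ?bb ?aba ?bab mul0r ?sub0r ?subr0.
Qed.

Lemma right_rels_left (B : pzRingType) (a b : B) :
  (forall x : B, x *+ 2 = 0 -> x = 0) -> right_rels a b -> left_rels a b.
Proof.
move=> two_inj [ah bh].
(* The letters are swapped because the commutator [b,a] of [B^c] is [a,b] in [B]. *)
have conv : left_rels (b : B^c) (a : B^c) by split.
by have [] := @left_rels_right B^c b a two_inj conv.
Qed.

End CommutatorRelations.

(** * Coordinates of the operations and relations in the envelopes *)

Section EnvelopeMorphisms.
Context (F : fieldType).

Let ord2_sum (f : 'I_2 -> F) : \sum_(i < 2) f i = f 0 + f 1.
Proof. by rewrite !big_ord_recl big_ord0 addr0; congr (_ + f _); apply: val_inj. Qed.

Lemma zdmx_diag0 (x : zdmx F) i : x i i = 0.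
Proof. by have /forallP/(_ i)/eqP := valP x. Qed.

(** Determinant of the coordinates of [x] and [y] in the basis [e1], [e2]. The matrix commutator
    [x,y] is this scalar times diag(1,-1), whence the signs in the four formulas below. *)
Definition zdet (x y : zdmx F) : F := x 0 1 * y 1 0 - y 0 1 * x 1 0.

Lemma zdmx_op_l01 x y z : zdmx_op omega_comm_l x y z 0 1 = zdet x y * z 0 1.
Proof.
by rewrite [LHS]/= omega_comm_lE /zdet !(mxE, ord2_sum) !zdmx_diag0; ring.
Qed.

Lemma zdmx_op_l10 x y z : zdmx_op omega_comm_l x y z 1 0 = - zdet x y * z 1 0.
Proof.
by rewrite [LHS]/= omega_comm_lE /zdet !(mxE, ord2_sum) !zdmx_diag0; ring.
Qed.

Lemma zdmx_op_r01 x y z : zdmx_op omega_comm_r x y z 0 1 = - zdet y z * x 0 1.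
Proof.
by rewrite [LHS]/= omega_comm_rE /zdet !(mxE, ord2_sum) !zdmx_diag0; ring.
Qed.

Lemma zdmx_op_r10 x y z : zdmx_op omega_comm_r x y z 1 0 = zdet y z * x 1 0.
Proof.
by rewrite [LHS]/= omega_comm_rE /zdet !(mxE, ord2_sum) !zdmx_diag0; ring.
Qed.

(** The commutator is bilinear and alternating, so on the span of [a] and [b] only the coordinate
    determinant matters. *)
Lemma lin_ext_comm (B : algType F) (a b : B) x y :
  lin_ext a b x * lin_ext a b y - lin_ext a b y * lin_ext a b x =
  zdet x y *: (a * b - b * a).
Proof.
rewrite /lin_ext !mulrDl !mulrDr -!scalerAl -!scalerAr !scalerA /zdet.
rewrite opprD addrACA.
(* Used twice: for the a a terms, then for the b b terms. *)
have cancel (p t t' : B) : p + t - (p + t') = t - t'.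
  by rewrite opprD addrACA subrr add0r.
rewrite [y 0 1 * x 0 1]mulrC cancel [y 1 0 * x 1 0]mulrC.
rewrite [X in _ + (X - _)]addrC [X in _ + (_ - X)]addrC cancel.
rewrite [y 1 0 * x 0 1]mulrC [x 1 0 * y 0 1]mulrC -!scalerBl.
by rewrite -[y 0 1 * x 1 0 - _]opprB scaleNr -scalerBr.
Qed.

(** By the relations, left multiplication by [a,b] acts on [a], [b] as diag(1,-1) does on [e1],
    [e2]. Two relations thus yield those for all triples. *)
Lemma lin_ext_op_l (B : algType F) (a b : B) x y z : left_rels a b ->
  triop_eval omega_comm_l (lin_ext a b x) (lin_ext a b y) (lin_ext a b z) =
  lin_ext a b (zdmx_op omega_comm_l x y z).
Proof.
move=> [ha hb]; rewrite omega_comm_lE lin_ext_comm {2}/lin_ext.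
rewrite zdmx_op_l01 zdmx_op_l10 /lin_ext mulrDr -!scalerAr -!scalerAl ha hb.
by rewrite !scalerA scalerN -scaleNr mulrC [- zdet _ _ * _]mulrC mulrN.
Qed.

Lemma lin_ext_op_r (B : algType F) (a b : B) x y z : right_rels a b ->
  triop_eval omega_comm_r (lin_ext a b x) (lin_ext a b y) (lin_ext a b z) =
  lin_ext a b (zdmx_op omega_comm_r x y z).
Proof.
move=> [ah bh]; rewrite omega_comm_rE lin_ext_comm {2}/lin_ext.
rewrite zdmx_op_r01 zdmx_op_r10 /lin_ext mulrDl -!scalerAr -!scalerAl ah bh.
by rewrite !scalerA scalerN -scaleNr mulNr.
Qed.

Lemma lin_ext_morph (B C : algType F) (g : {lrmorphism B -> C}) a b x :
  g (lin_ext a b x) = lin_ext (g a) (g b) x.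
Proof. by rewrite /lin_ext raddfD /= !linearZ. Qed.

Lemma triop_eval_morph (B C : algType F) (g : {lrmorphism B -> C}) w x y z :
  g (triop_eval w x y z) = triop_eval w (g x) (g y) (g z).
Proof. by rewrite /triop_eval !raddfD /= !linearZ /= !rmorphM. Qed.

Definition envelope_pi w : {lrmorphism freealg2 F -> envelope F w} :=
  @quotalg_pi F _ (@envelope_ideal F w).

Lemma envelope_pi_eq0 w p : envelope_pi w p = 0 <-> p \in @envelope_ideal F w.
Proof.
by rewrite -(raddf0 (envelope_pi w)) -{2}[p]subr0; apply: quotalg_piP.
Qed.

Notation "''a_' w" := (envelope_pi w (gen_a F)) (at level 8, w at level 2).
Notation "''b_' w" := (envelope_pi w (gen_b F)) (at level 8, w at level 2).

Lemma envelope_lin_ext w x y z :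
  x \in [:: e1 F; e2 F] -> y \in [:: e1 F; e2 F] -> z \in [:: e1 F; e2 F] ->
  triop_eval w (lin_ext 'a_w 'b_w x) (lin_ext 'a_w 'b_w y) (lin_ext 'a_w 'b_w z)
  = lin_ext 'a_w 'b_w (zdmx_op w x y z).
Proof.
move=> ex ey ez; apply/eqP; rewrite -subr_eq0; apply/eqP.
rewrite -!lin_ext_morph -triop_eval_morph -raddfB; apply/envelope_pi_eq0.
by apply: mem_ideal_gen; exists x, y, z.
Qed.

Let e1_in : e1 F \in [:: e1 F; e2 F]. Proof. by rewrite mem_head. Qed.
Let e2_in : e2 F \in [:: e1 F; e2 F]. Proof. by rewrite !inE eqxx orbT. Qed.

Let e1E : (e1 F 0 1 = 1) * (e1 F 1 0 = 0). Proof. by split; rewrite !mxE. Qed.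
Let e2E : (e2 F 0 1 = 0) * (e2 F 1 0 = 1). Proof. by split; rewrite !mxE. Qed.

Let zdet12 : zdet (e1 F) (e2 F) = 1.
Proof. by rewrite /zdet !e1E !e2E mulr1 mulr0 subr0. Qed.

Lemma envelope_left_rels : left_rels 'a_omega_comm_l 'b_omega_comm_l.
Proof.
split.
  (* Triples starting with [e1], [e2] have determinant 1 and give the relations without extra
     scalars. *)
  have := envelope_lin_ext omega_comm_l e1_in e2_in e1_in.
  rewrite omega_comm_lE !lin_ext_e1 !lin_ext_e2 => ->.
  rewrite /lin_ext zdmx_op_l01 zdmx_op_l10 zdet12 !e1E.
  by rewrite mulr1 mulr0 scale1r scale0r addr0.
have := envelope_lin_ext omega_comm_l e1_in e2_in e2_in.
rewrite omega_comm_lE !lin_ext_e1 !lin_ext_e2 => ->.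
rewrite /lin_ext zdmx_op_l01 zdmx_op_l10 zdet12 !e2E.
by rewrite mulr1 mulr0 scaleN1r scale0r add0r.
Qed.

Lemma envelope_right_rels : right_rels 'a_omega_comm_r 'b_omega_comm_r.
Proof.
split.
  (* Here the pair [e1], [e2] fills the last two places, where the commutator is taken. *)
  have := envelope_lin_ext omega_comm_r e1_in e1_in e2_in.
  rewrite omega_comm_rE !lin_ext_e1 !lin_ext_e2 => ->.
  rewrite /lin_ext zdmx_op_r01 zdmx_op_r10 zdet12 !e1E.
  by rewrite mulr1 mulr0 scaleN1r scale0r addr0.
have := envelope_lin_ext omega_comm_r e2_in e1_in e2_in.
rewrite omega_comm_rE !lin_ext_e1 !lin_ext_e2 => ->.
rewrite /lin_ext zdmx_op_r01 zdmx_op_r10 zdet12 !e2E.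
by rewrite mulr1 mulr0 scale1r scale0r add0r.
Qed.

(** The ideal of [w'] is the kernel of its projection, so it is enough that this projection kills
    the generators for [w]. *)
Lemma envelope_idealS w w' :
  (forall x y z, triop_eval w (lin_ext 'a_w' 'b_w' x) (lin_ext 'a_w' 'b_w' y)
      (lin_ext 'a_w' 'b_w' z) = lin_ext 'a_w' 'b_w' (zdmx_op w x y z)) ->
  {subset @envelope_ideal F w <= @envelope_ideal F w'}.
Proof.
move=> w_w' p pI; apply/envelope_pi_eq0; move: pI.
apply: ideal_gen_ker => _ [x [y [z [_ _ _ ->]]]].
have := w_w' x y z; rewrite -!lin_ext_morph -triop_eval_morph => E.
by rewrite raddfB; apply/eqP; rewrite subr_eq0; apply/eqP.
Qed.

End EnvelopeMorphisms.

(** * Maps between quotients by nested ideals *)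

Section QuotientMap.
Context (F : fieldType) (B : algType F) (I J : ideal2 B).
Hypothesis sIJ : {subset (I : {pred B}) <= (J : {pred B})}.

(** Independence of the representative is [quotalg_map_pi], which rests on the inclusion of [I] in
    [J]. *)
Definition quotalg_map (x : quotalg I) : quotalg J := quotalg_pi J (quotalg_repr x).

Lemma quotalg_map_pi x : quotalg_map (quotalg_pi I x) = quotalg_pi J x.
Proof. exact/quotalg_piP/sIJ/quotalg_piK. Qed.

Lemma quotalg_map_zmod : zmod_morphism quotalg_map.
Proof.
move=> x y; rewrite -[x]quotalg_reprK -[y]quotalg_reprK -raddfB.
by rewrite !quotalg_map_pi raddfB.
Qed.

Lemma quotalg_map_monoid : monoid_morphism quotalg_map.
Proof.
split=> [|x y]; first by rewrite -(rmorph1 (quotalg_pi I)) quotalg_map_pi rmorph1.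
rewrite -[x]quotalg_reprK -[y]quotalg_reprK -rmorphM.
by rewrite !quotalg_map_pi rmorphM.
Qed.

Lemma quotalg_map_scalable : scalable quotalg_map.
Proof.
by move=> k x; rewrite -[x]quotalg_reprK -linearZ !quotalg_map_pi linearZ.
Qed.

HB.instance Definition _ :=
  GRing.isZmodMorphism.Build (quotalg I) (quotalg J) quotalg_map quotalg_map_zmod.
HB.instance Definition _ :=
  GRing.isMonoidMorphism.Build (quotalg I) (quotalg J) quotalg_map quotalg_map_monoid.
HB.instance Definition _ :=
  GRing.isScalable.Build F (quotalg I) (quotalg J) *:%R quotalg_map
    quotalg_map_scalable.

Definition quotalg_lrmap : {lrmorphism quotalg I -> quotalg J} := quotalg_map.

End QuotientMap.

Lemma eq_ideal_quotalg_iso (F : fieldType) (B : algType F) (I J : ideal2 B) :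
  (I : {pred B}) =i (J : {pred B}) ->
  exists f : {lrmorphism quotalg I -> quotalg J}, bijective f.
Proof.
move=> eqIJ.
have sIJ : {subset (I : {pred B}) <= (J : {pred B})} by move=> x; rewrite eqIJ.
have sJI : {subset (J : {pred B}) <= (I : {pred B})} by move=> x; rewrite eqIJ.
(* Both maps send the class of an element to its class, so they are mutually inverse. *)
exists (quotalg_lrmap sIJ); exists (quotalg_lrmap sJI) => x.
  by rewrite -[x]quotalg_reprK /= !quotalg_map_pi.
by rewrite -[x]quotalg_reprK /= !quotalg_map_pi.
Qed.

Theorem proposition5p6 (F : fieldType) (charF0 : [pchar F] =i pred0) :
  exists f : {lrmorphism envelope F omega_comm_l -> envelope F omega_comm_r},
    bijective f.
Proof.
have two_inj (B : algType F) (x : B) : x *+ 2 = 0 -> x = 0.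
  (* Doubling is scaling by 2, which is nonzero in characteristic 0. *)
  move=> /eqP; rewrite -scaler_nat scaler_eq0 => /orP[|/eqP //].
  by have /pcharf0P -> := charF0.
apply: eq_ideal_quotalg_iso => p; apply/idP/idP; apply: envelope_idealS => x y z.
(* For each inclusion, the target envelope supplies its own pair of relations, which is converted
   into the other pair. *)
- apply: lin_ext_op_l; apply: right_rels_left; first exact: two_inj.
  exact: envelope_right_rels.
- apply: lin_ext_op_r; apply: left_rels_right; first exact: two_inj.
  exact: envelope_left_rels.
Qed.
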